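(* For every $\mathcal{L}_{\mathrm{BPL}}$-formula $A$: $A$ is provable in $\mathsf{BPL}$ if and only if both sequents $\top\Rightarrow A$ and $A\Rightarrow\top$ are derivable in $\mathsf{S^*_{RBL}}$.
   Context: $\mathcal{L}_{\mathrm{BPL}}$-formulas are built from propositional letters and $\bot,\top$ by $\wedge,\vee,\rightarrow$; $\mathcal{L}_{\mathrm{RBL}}$-formulas additionally use the binary connectives $\cdot$ and $\leftarrow$. $\mathsf{BPL}$ (Visser's basic propositional logic) is the Hilbert system with axioms (for all formulas $A,B,C$): $A\rightarrow A$; $A\rightarrow(B\rightarrow A)$; $(A\rightarrow B)\wedge(B\rightarrow C)\rightarrow(A\rightarrow C)$; $(A\rightarrow C)\wedge(B\rightarrow C)\rightarrow(A\vee B\rightarrow C)$; $A\wedge B\rightarrow A$; $A\wedge B\rightarrow B$; $A\rightarrow A\vee B$; $B\rightarrow A\vee B$; $A\rightarrow(B\rightarrow A\wedge B)$; $(A\rightarrow B)\wedge(A\rightarrow C)\rightarrow(A\rightarrow B\wedge C)$; $A\wedge(B\vee C)\rightarrow(A\wedge B)\vee(A\wedge C)$; $\bot\rightarrow A$; and the single rule modus ponens (from $A$ and $A\rightarrow B$ infer $B$). The system $\mathsf{S^*_{RBL}}$ derives sequents $A\Rightarrow B$ between $\mathcal{L}_{\mathrm{RBL}}$-formulas from the axioms $A\Rightarrow A$; $\bot\Rightarrow A$; $A\Rightarrow\top$; $A\wedge(B\vee C)\Rightarrow(A\wedge B)\vee(A\wedge C)$; $\top\Rightarrow A\rightarrow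 A$; $A\Rightarrow\top\rightarrow A$; $(A\rightarrow B)\wedge(B\rightarrow C)\Rightarrow A\rightarrow C$; using the rules: Cut (from $A\Rightarrow B$ and $B\Rightarrow C$ infer $A\Rightarrow C$); from $A\cdot B\Rightarrow C$ infer $B\Rightarrow A\rightarrow C$ and conversely; from $A\cdot B\Rightarrow C$ infer $A\Rightarrow C\leftarrow B$ and conversely; from $A_i\Rightarrow B$ infer $A_1\wedge A_2\Rightarrow B$; from $C\Rightarrow A$ and $C\Rightarrow B$ infer $C\Rightarrow A\wedge B$; from $A\Rightarrow C$ and $B\Rightarrow C$ infer $A\vee B\Rightarrow C$; from $C\Rightarrow A_i$ infer $C\Rightarrow A_1\vee A_2$ ($i=1,2$).
   Formalization: The listed axioms of BPL say nothing about ⊤, so ⊤ is unprovable there although ⊤ ⇒ ⊤ is derivable; the formal BPL adds the axiom schema A → ⊤, which proves no new formula without ⊤. *)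

(* Defs.v *)
(* The propositional letters form a denumerable set, indexed by [nat]. *)

Inductive bpl_form : Type :=
| BVar (p : nat)
| BBot
| BTop
| BAnd (A B : bpl_form)
| BOr (A B : bpl_form)
| BImp (A B : bpl_form).

(* [RRes A B] is A → B, the right adjoint of A · _;
   [RLres C B] is C ← B, the right adjoint of _ · B (antecedent on the right). *)
Inductive rbl_form : Type :=
| RVar (p : nat)
| RBot
| RTop
| RAnd (A B : rbl_form)
| ROr (A B : rbl_form)
| RRes (A B : rbl_form)
| RMul (A B : rbl_form)
| RLres (C B : rbl_form).

Fixpoint embed (A : bpl_form) : rbl_form :=
  match A with
  | BVar p => RVar p
  | BBot => RBot
  | BTop => RTop
  | BAnd A B => RAnd (embed A) (embed B)
  | BOr A B => ROr (embed A) (embed B)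
  | BImp A B => RRes (embed A) (embed B)
  end.

Declare Scope bpl_scope.
Delimit Scope bpl_scope with bpl.
Bind Scope bpl_scope with bpl_form.
Local Notation "⊥" := BBot : bpl_scope.
Local Notation "⊤" := BTop : bpl_scope.
Local Notation "A ∧ B" := (BAnd A B) (at level 80, right associativity) : bpl_scope.
Local Notation "A ∨ B" := (BOr A B) (at level 85, right associativity) : bpl_scope.
Local Notation "A → B" := (BImp A B) (at level 90, right associativity) : bpl_scope.

(* [BPL_top] is the axiom for the primitive constant ⊤, dual to [BPL_bot]: no
   other axiom mentions ⊤, so without it ⊤ would behave as an arbitrary
   propositional letter and would not be provable.  Adding it proves no new
   formula in which ⊤ does not occur (replace ⊤ by ⊥ → ⊥). *)
Inductive BPL : bpl_form -> Prop :=
| BPL_id A : BPL (A → A)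
| BPL_weak A B : BPL (A → (B → A))
| BPL_trans A B C : BPL ((A → B) ∧ (B → C) → (A → C))
| BPL_or_elim A B C : BPL ((A → C) ∧ (B → C) → (A ∨ B → C))
| BPL_and_l A B : BPL (A ∧ B → A)
| BPL_and_r A B : BPL (A ∧ B → B)
| BPL_or_l A B : BPL (A → A ∨ B)
| BPL_or_r A B : BPL (B → A ∨ B)
| BPL_and_intro A B : BPL (A → (B → A ∧ B))
| BPL_imp_and A B C : BPL ((A → B) ∧ (A → C) → (A → B ∧ C))
| BPL_distr A B C : BPL (A ∧ (B ∨ C) → (A ∧ B) ∨ (A ∧ C))
| BPL_bot A : BPL (⊥ → A)
| BPL_top A : BPL (A → ⊤)
| BPL_mp A B : BPL A -> BPL (A → B) -> BPL B.

Declare Scope rbl_scope.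
Delimit Scope rbl_scope with rbl.
Bind Scope rbl_scope with rbl_form.
Local Notation "⊥" := RBot : rbl_scope.
Local Notation "⊤" := RTop : rbl_scope.
Local Notation "A · B" := (RMul A B) (at level 40, left associativity) : rbl_scope.
Local Notation "A ∧ B" := (RAnd A B) (at level 80, right associativity) : rbl_scope.
Local Notation "A ∨ B" := (ROr A B) (at level 85, right associativity) : rbl_scope.
Local Notation "A → B" := (RRes A B) (at level 90, right associativity) : rbl_scope.
Local Notation "C ← B" := (RLres C B) (at level 91, no associativity) : rbl_scope.

Reserved Notation "A ⇒ B" (at level 95, no associativity).

(* [SRBL A B] is derivability of the sequent A ⇒ B. *)
Inductive SRBL : rbl_form -> rbl_form -> Prop :=
| SRBL_id A : A ⇒ A
| SRBL_bot A : ⊥ ⇒ A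
| SRBL_top A : A ⇒ ⊤
| SRBL_distr A B C : A ∧ (B ∨ C) ⇒ (A ∧ B) ∨ (A ∧ C)
| SRBL_imp_refl A : ⊤ ⇒ A → A
| SRBL_imp_top A : A ⇒ ⊤ → A
| SRBL_imp_trans A B C : (A → B) ∧ (B → C) ⇒ A → C
| SRBL_cut A B C : (A ⇒ B) -> (B ⇒ C) -> (A ⇒ C)
| SRBL_res_intro A B C : (A · B ⇒ C) -> (B ⇒ A → C)
| SRBL_res_elim A B C : (B ⇒ A → C) -> (A · B ⇒ C)
| SRBL_lres_intro A B C : (A · B ⇒ C) -> (A ⇒ C ← B)
| SRBL_lres_elim A B C : (A ⇒ C ← B) -> (A · B ⇒ C)
| SRBL_and_l1 A1 A2 B : (A1 ⇒ B) -> (A1 ∧ A2 ⇒ B)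
| SRBL_and_l2 A1 A2 B : (A2 ⇒ B) -> (A1 ∧ A2 ⇒ B)
| SRBL_and_r A B C : (C ⇒ A) -> (C ⇒ B) -> (C ⇒ A ∧ B)
| SRBL_or_l A B C : (A ⇒ C) -> (B ⇒ C) -> (A ∨ B ⇒ C)
| SRBL_or_r1 A1 A2 C : (C ⇒ A1) -> (C ⇒ A1 ∨ A2)
| SRBL_or_r2 A1 A2 C : (C ⇒ A2) -> (C ⇒ A1 ∨ A2)
where "A ⇒ B" := (SRBL A B) : type_scope.

(* Main.v *)
(** From BPL to sequents, the difficulty is modus ponens: from [⊤ ⇒ A → B] one
    only gets [A · ⊤ ⇒ B], and [⊤ ⇒ ⊤ · ⊤] fails.  It is admissible in a
    sequent calculus for the language of BPL, where one can glue an irreflexive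
    root below all models: the root satisfies [A → B] exactly when [A ⊢ B] is
    derivable, and satisfies exactly the [A] such that [⊤ ⊢ A] is derivable.

    From sequents to BPL, the calculus is sound for transitive Kripke models
    with persistent valuations, where [A · B] holds at [w] when [A] holds at
    [w] and [B] holds at some predecessor of [w].  A formula not provable in
    BPL fails in the canonical model, whose worlds are the prime theories. *)

From Stdlib Require Import Cantor Classical ClassicalEpsilon Lia.
Require Import Defs.

(** * A sequent calculus for [BPL] with admissible modus ponens *)

Inductive bpl_seq : bpl_form -> bpl_form -> Prop :=
| seq_id A : bpl_seq A A
| seq_cut A B C : bpl_seq A B -> bpl_seq B C -> bpl_seq A C
| seq_bot A : bpl_seq BBot A
| seq_top A : bpl_seq A BTop
| seq_and_l A B : bpl_seq (BAnd A B) A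
| seq_and_r A B : bpl_seq (BAnd A B) B
| seq_and A B C : bpl_seq C A -> bpl_seq C B -> bpl_seq C (BAnd A B)
| seq_or_l A B : bpl_seq A (BOr A B)
| seq_or_r A B : bpl_seq B (BOr A B)
| seq_or A B C : bpl_seq A C -> bpl_seq B C -> bpl_seq (BOr A B) C
| seq_distr A B C :
    bpl_seq (BAnd A (BOr B C)) (BOr (BAnd A B) (BAnd A C))
| seq_imp A B C : bpl_seq (BAnd A B) C -> bpl_seq A (BImp B C)
| seq_imp_trans A B C :
    bpl_seq (BAnd (BImp A B) (BImp B C)) (BImp A C)
| seq_imp_and A B C :
    bpl_seq (BAnd (BImp A B) (BImp A C)) (BImp A (BAnd B C))
| seq_imp_or A B C :
    bpl_seq (BAnd (BImp A C) (BImp B C)) (BImp (BOr A B) C).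

Lemma seq_imp_top A B : bpl_seq A B -> bpl_seq BTop (BImp A B).
Proof.
  intros H. apply seq_imp. exact (seq_cut _ _ _ (seq_and_r _ _) H).
Qed.

Fixpoint root (A : bpl_form) : Prop :=
  match A with
  | BVar _ => False
  | BBot => False
  | BTop => True
  | BAnd A B => root A /\ root B
  | BOr A B => root A \/ root B
  | BImp A B => bpl_seq A B
  end.

Lemma root_seq A : root A -> bpl_seq BTop A.
Proof.
  induction A; simpl; intros H.
  - contradiction.
  - contradiction.
  - apply seq_top.
  - destruct H. apply seq_and; auto.
  - destruct H as [H | H].
    + apply (seq_cut _ A1); auto using seq_or_l.
    + apply (seq_cut _ A2); auto using seq_or_r.
  - now apply seq_imp_top.
Qed.

Lemma seq_root A B : bpl_seq A B -> root A -> root B.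
Proof.
  intros H. induction H; simpl; try tauto.
  (* Truth of [A] at the root makes [A] derivable from [⊤], so [B] alone yields [A ∧ B]. *)
  - intros HA. apply (seq_cut _ (BAnd A B)); [| assumption].
    apply seq_and; [| apply seq_id].
    apply (seq_cut _ BTop); [apply seq_top | now apply root_seq].
  - intros []; eauto using seq_cut.
  - intros []; auto using seq_and.
  - intros []; auto using seq_or.
Qed.

Lemma seq_mp A B :
  bpl_seq BTop A -> bpl_seq BTop (BImp A B) -> bpl_seq BTop B.
Proof.
  intros HA HAB. apply (seq_cut _ A); [assumption |].
  (* [root (BImp A B)] computes to [bpl_seq A B]. *)
  exact (seq_root _ _ HAB I).
Qed.

Lemma bpl_to_seq A : BPL A -> bpl_seq BTop A.
Proof.
  induction 1; try (apply seq_imp_top; constructor; fail).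
  - apply seq_imp_top, seq_imp, seq_and_l.
  - apply seq_imp_top, seq_imp, seq_id.
  - eauto using seq_mp.
Qed.

(** * From the sequent calculus to [SRBL] *)

Lemma srbl_mul_l A B : SRBL (RMul A B) A.
Proof.
  apply SRBL_res_elim, (SRBL_cut _ RTop); [apply SRBL_top | apply SRBL_imp_refl].
Qed.

(** Residuating on [←] lets [A] be weakened to [⊤]; the case of [⊤] is the axiom [B ⇒ ⊤ → B]. *)
Lemma srbl_mul_r A B : SRBL (RMul A B) B.
Proof.
  apply SRBL_lres_elim, (SRBL_cut _ RTop); [apply SRBL_top |].
  apply SRBL_lres_intro, SRBL_res_elim, SRBL_imp_top.
Qed.

Lemma srbl_res_of_and A B C : SRBL (RAnd A B) C -> SRBL A (RRes B C).
Proof.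
  intros H. apply SRBL_res_intro, (SRBL_cut _ (RAnd A B)); [| assumption].
  apply SRBL_and_r; [apply srbl_mul_r | apply srbl_mul_l].
Qed.

(** Having the right adjoint [_ ← X], the map [_ · X] preserves disjunctions. *)
Lemma srbl_res_or A B X D :
  SRBL X (RRes A D) -> SRBL X (RRes B D) -> SRBL X (RRes (ROr A B) D).
Proof.
  intros HA HB. apply SRBL_res_intro, SRBL_lres_elim, SRBL_or_l;
  now apply SRBL_lres_intro, SRBL_res_elim.
Qed.

Lemma seq_to_srbl A B : bpl_seq A B -> SRBL (embed A) (embed B).
Proof.
  induction 1; simpl; eauto using SRBL.
  - now apply srbl_res_of_and.
  - apply SRBL_res_intro, SRBL_and_r; apply SRBL_res_elim; eauto using SRBL.
  - apply srbl_res_or; eauto using SRBL.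
Qed.

(** * Kripke semantics and soundness of [SRBL] *)

Record kripke : Type := {
  world : Type;
  acc : world -> world -> Prop;
  acc_trans : forall u v w, acc u v -> acc v w -> acc u w;
  val : nat -> world -> Prop;
  val_mono : forall p u v, acc u v -> val p u -> val p v
}.

(* For [RLres] the bare condition at [w] is not persistent, since a predecessor
   of a successor of [w] need not be related to [w]. *)
Fixpoint forces (K : kripke) (A : rbl_form) (w : world K) : Prop :=
  match A with
  | RVar p => val K p w
  | RBot => False
  | RTop => True
  | RAnd A B => forces K A w /\ forces K B w
  | ROr A B => forces K A w \/ forces K B w
  | RRes A B => forall v, acc K w v -> forces K A v -> forces K B v
  | RMul A B => forces K A w /\ exists v, acc K v w /\ forces K B v
  | RLres C B => forall v, w = v \/ acc K w v ->
      forall u, acc K u v -> forces K B u -> forces K C v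
  end.

Lemma forces_mono K A u v : acc K u v -> forces K A u -> forces K A v.
Proof.
  revert u v. induction A; simpl; intros u v Huv; try tauto.
  - now apply val_mono.
  - intros []; eauto.
  - intros []; eauto.
  - intros H w Hvw. apply H. eapply acc_trans; eauto.
  - intros [HA [w [Hw HB]]]. split; eauto using acc_trans.
  - intros H w Hw. apply H. right.
    destruct Hw as [<- | Hw]; eauto using acc_trans.
Qed.

Lemma srbl_sound A B : SRBL A B ->
  forall K w, forces K A w -> forces K B w.
Proof.
  induction 1; intros K w; simpl in *; try (intuition auto; fail).
  - intros HA v Hv _. now apply (forces_mono K A w).
  - intros HB v Hv HA. apply IHSRBL. eauto.
  - intros [HA [v [Hv HB]]]. now apply (IHSRBL K v).
  - intros HA v Hv u Hu HB. apply IHSRBL. split; [| eauto].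
    destruct Hv as [<- | Hv]; [assumption | now apply (forces_mono K A w)].
  - intros [HA [v [Hv HB]]]. apply (IHSRBL K w HA w (or_introl eq_refl) v); auto.
Qed.

(** * Enumeration of formulas and prime theories *)

Fixpoint code (A : bpl_form) : nat :=
  match A with
  | BVar p => to_nat (0, p)
  | BBot => to_nat (1, 0)
  | BTop => to_nat (2, 0)
  | BAnd A B => to_nat (3, to_nat (code A, code B))
  | BOr A B => to_nat (4, to_nat (code A, code B))
  | BImp A B => to_nat (5, to_nat (code A, code B))
  end.

Lemma code_inj A B : code A = code B -> A = B.
Proof.
  revert B. induction A; intros []; cbn [code]; intros H;
    apply to_nat_inj, pair_equal_spec in H; destruct H as [Htag H];
    try discriminate Htag; try reflexivity; try (now rewrite H);
    apply to_nat_inj, pair_equal_spec in H; destruct H; f_equal; auto.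
Qed.

Lemma bpl_form_enum : exists e : nat -> bpl_form, forall A, exists n, e n = A.
Proof.
  (* [epsilon] inverts [code]; a number that is no code gets an arbitrary formula. *)
  exists (fun n => epsilon (inhabits BTop) (fun A => code A = n)).
  intros A. exists (code A). apply code_inj.
  apply (epsilon_spec (inhabits BTop) (fun B => code B = code A)). now exists A.
Qed.

(** Abstracts two orders: provability of [A → B], and membership of [A → B] in a prime theory. *)
Record distr_order (le : bpl_form -> bpl_form -> Prop) : Prop := {
  le_bpl : forall A B, BPL (BImp A B) -> le A B;
  le_trans : forall A B C, le A B -> le B C -> le A C;
  le_and : forall A B C, le A B -> le A C -> le A (BAnd B C);
  le_or : forall A B C, le A C -> le B C -> le (BOr A B) C
}.

(** Closure is under provable implications only: [A] and [A → B] may lie in [F] without [B], as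
    worlds may be irreflexive. *)
Record prime_theory (F : bpl_form -> Prop) : Prop := {
  th_bpl : forall A B, BPL (BImp A B) -> F A -> F B;
  th_top : F BTop;
  th_and : forall A B, F A -> F B -> F (BAnd A B);
  th_bot : ~ F BBot;
  th_prime : forall A B, F (BOr A B) -> F A \/ F B
}.

(** Lindenbaum construction: starting from [a], meet with each formula in turn unless the result
    falls below [b]. The formulas above some member of this decreasing chain form [F]. *)
Lemma prime_extension le a b : distr_order le -> ~ le a b ->
  exists F, prime_theory F /\ F a /\ ~ F b /\
    forall A B, le A B -> F A -> F B.
Proof.
  intros [lebpl letr leand leor] Hab.
  destruct bpl_form_enum as [e He].
  set (c := fix c n := match n with
    | 0 => a
    | S n => if excluded_middle_informative (le (BAnd (c n) (e n)) b)
             then c n else BAnd (c n) (e n)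
    end).
  assert (Hc : forall n, ~ le (c n) b).
  { intros n. induction n as [| n IH]; simpl; [assumption |].
    now destruct (excluded_middle_informative _). }
  assert (Hdec : forall n m, n <= m -> le (c m) (c n)).
  { intros n m Hnm. induction Hnm as [| m Hnm IH].
    - apply lebpl, BPL_id.
    - apply (letr _ (c m)); [| assumption]. simpl.
      destruct (excluded_middle_informative _); apply lebpl;
        [apply BPL_id | apply BPL_and_l]. }
  assert (Hdich : forall A,
    (exists n, le (c n) A) \/ exists n, le (BAnd (c n) A) b).
  { intros A. destruct (He A) as [n <-].
    destruct (excluded_middle_informative (le (BAnd (c n) (e n)) b)) as [H | H].
    - right. now exists n.
    - left. exists (S n). simpl.
      destruct (excluded_middle_informative _); [contradiction |].
      apply lebpl, BPL_and_r. }
  exists (fun A => exists n, le (c n) A).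
  split; [split | split; [| split]].
  - intros A B HAB [n Hn]. exists n. eauto.
  - exists 0. apply lebpl, BPL_top.
  - intros A B [n Hn] [m Hm]. exists (max n m).
    apply leand; [apply (letr _ (c n)) | apply (letr _ (c m))]; auto;
      apply Hdec; lia.
  - intros [n Hn]. apply (Hc n). apply (letr _ BBot); [assumption |].
    apply lebpl, BPL_bot.
  - intros A B [k Hk].
    destruct (Hdich A) as [HA | [n Hn]]; [now left |].
    destruct (Hdich B) as [HB | [m Hm]]; [now right |].
    (* [c N] is below [A ∨ B], while its meets with [A] and with [B] are below [b]; distributivity
       puts [c N] below [b]. *)
    exfalso. set (N := k + n + m). apply (Hc N).
    assert (Hmono : forall i X, i <= N -> le (BAnd (c N) X) (BAnd (c i) X)).
    { intros i X Hi. apply leand; [| apply lebpl, BPL_and_r].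
      apply (letr _ (c N)); [apply lebpl, BPL_and_l | now apply Hdec]. }
    apply (letr _ (BAnd (c N) (BOr A B))).
    { apply leand; [apply lebpl, BPL_id |].
      apply (letr _ (c k)); [apply Hdec; lia | assumption]. }
    apply (letr _ (BOr (BAnd (c N) A) (BAnd (c N) B)));
      [apply lebpl, BPL_distr |].
    apply leor; [apply (letr _ (BAnd (c n) A)) | apply (letr _ (BAnd (c m) B))];
      auto; apply Hmono; lia.
  - exists 0. apply lebpl, BPL_id.
  - intros [n Hn]. now apply (Hc n).
  - intros A B HAB [n Hn]. eauto.
Qed.

Lemma bpl_and A B : BPL A -> BPL B -> BPL (BAnd A B).
Proof.
  intros HA HB. apply (BPL_mp B); [assumption |].
  apply (BPL_mp A); [assumption | apply BPL_and_intro].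
Qed.

Lemma bpl_distr_order : distr_order (fun A B => BPL (BImp A B)).
Proof.
  split; [auto | | |]; intros A B C H1 H2;
    apply (BPL_mp _ _ (bpl_and _ _ H1 H2)).
  - apply BPL_trans.
  - apply BPL_imp_and.
  - apply BPL_or_elim.
Qed.

(** The order laws are axioms of [BPL], so they apply to implications that [F] contains without
    [BPL] proving them. *)
Lemma theory_distr_order F :
  prime_theory F -> distr_order (fun A B => F (BImp A B)).
Proof.
  intros [Fbpl Ftop Fand _ _]. split.
  - intros A B H. apply (Fbpl BTop); [| assumption].
    apply (BPL_mp _ _ H), BPL_weak.
  - intros A B C H1 H2. exact (Fbpl _ _ (BPL_trans A B C) (Fand _ _ H1 H2)).
  - intros A B C H1 H2. exact (Fbpl _ _ (BPL_imp_and A B C) (Fand _ _ H1 H2)).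
  - intros A B C H1 H2. exact (Fbpl _ _ (BPL_or_elim A B C) (Fand _ _ H1 H2)).
Qed.

(** * The canonical model and completeness *)

Definition theory_acc (F G : bpl_form -> Prop) : Prop :=
  forall A B, F (BImp A B) -> G A -> G B.

(** Weakening puts [⊤ → A] in [F], and [⊤] is in [G]. *)
Lemma theory_acc_incl F G A :
  prime_theory F -> prime_theory G -> theory_acc F G -> F A -> G A.
Proof.
  intros HF HG HFG HA. apply (HFG BTop); [| now apply th_top].
  apply (th_bpl F HF A); [apply BPL_weak | assumption].
Qed.

Program Definition canonical : kripke := {|
  world := {F | prime_theory F};
  acc F G := theory_acc (proj1_sig F) (proj1_sig G);
  val p F := proj1_sig F (BVar p)
|}.
Next Obligation.
  simpl in *. intros A B HAB. apply H0.
  now apply (theory_acc_incl u v).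
Qed.
Next Obligation.
  simpl in *. now apply (theory_acc_incl u v).
Qed.

Lemma truth A (F : world canonical) :
  forces canonical (embed A) F <-> proj1_sig F A.
Proof.
  revert F. induction A as [p | | | A IHA B IHB | A IHA B IHB | A IHA B IHB];
    intros [F HF]; simpl.
  - reflexivity.
  - pose proof (th_bot F HF). tauto.
  - pose proof (th_top F HF). tauto.
  - rewrite IHA, IHB. simpl. split.
    + intros []. now apply th_and.
    + intros H. split; revert H; apply (th_bpl F HF); constructor.
  - rewrite IHA, IHB. simpl. split.
    + intros [H | H]; revert H; apply (th_bpl F HF); constructor.
    + now apply th_prime.
  - split.
    + intros H. apply NNPP. intros Hn.
      (* For the order given by [F], upward closure of [G] is exactly accessibility from [F]. *)
      destruct (prime_extension (fun X Y => F (BImp X Y)) A B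
                  (theory_distr_order F HF) Hn) as [G [HG [HGA [HGB HFG]]]].
      apply HGB. apply (IHB (exist _ G HG)). apply H; [exact HFG |].
      now apply IHA.
    + intros H [G HG] HFG HA. apply IHB. apply (HFG A); [exact H |].
      now apply IHA in HA.
Qed.

Theorem theorem4 : forall A : bpl_form,
  BPL A <-> (SRBL RTop (embed A) /\ SRBL (embed A) RTop).
Proof.
  intros A. split.
  - intros H. split; [| apply SRBL_top].
    exact (seq_to_srbl _ _ (bpl_to_seq _ H)).
  - intros [H _]. apply NNPP. intros Hn.
    destruct (prime_extension (fun X Y => BPL (BImp X Y)) BTop A)
      as [F [HF [_ [HA _]]]].
    + apply bpl_distr_order.
    (* [⊤] is provable, so a proof of [⊤ → A] would give one of [A]. *)
    + intros HA. apply Hn, (BPL_mp BTop); [| assumption].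
      apply (BPL_mp (BImp BTop BTop)); [apply BPL_id | apply BPL_top].
    + apply HA, (truth A (exist _ F HF)), (srbl_sound _ _ H). exact I.
Qed.
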